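(* For all integers $n_1\ge n_2\ge\dots\ge n_d\ge 2$, $$\Big\lfloor\frac{n_1}{2}\Big\rfloor\prod_{i=2}^{d}\big\lfloor\sqrt{n_i}\big\rfloor\ \le\ \eta(K_{n_1}\,\square\,K_{n_2}\,\square\,\cdots\,\square\,K_{n_d})\ <\ \sqrt d\, n_1\prod_{i=2}^d\sqrt{n_i}+3.$$
   Context: All graphs are finite, simple and undirected. $K_n$ is the complete graph on $n$ vertices. The Cartesian product $G\,\square\,H$ has vertex set $V(G)\times V(H)$, with $(v,x)(w,y)$ an edge iff ($vw\in E(G)$ and $x=y$) or ($v=w$ and $xy\in E(H)$); it is associative. $\eta(G)$ is the maximum $k$ such that $K_k$ is a minor of $G$. *)

(* Defs.v *)
From HB Require Import structures.
From mathcomp Require Import all_boot all_order all_algebra.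
From mathcomp Require Import reals.

Set Implicit Arguments.
Unset Strict Implicit.
Unset Printing Implicit Defensive.

Record sgraph := SGraph {
  vertex :> finType;
  edge : rel vertex;
  edge_sym : symmetric edge;
  edge_irr : irreflexive edge }.

Section CompleteGraph.
Variable n : nat.

Definition complete_edge : rel 'I_n := [rel x y | x != y].

Lemma complete_edge_sym : symmetric complete_edge.
Proof. by move=> x y; rewrite /complete_edge /= eq_sym. Qed.

Lemma complete_edge_irr : irreflexive complete_edge.
Proof. by move=> x; rewrite /complete_edge /= eqxx. Qed.

Definition complete : sgraph := SGraph complete_edge_sym complete_edge_irr.

End CompleteGraph.

Section CartesianProduct.
Variables G H : sgraph.

Definition cart_edge : rel (G * H)%type :=
  [rel u v | edge u.1 v.1 && (u.2 == v.2) || (u.1 == v.1) && edge u.2 v.2].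

Lemma cart_edge_sym : symmetric cart_edge.
Proof.
move=> u v; rewrite /cart_edge /= (edge_sym u.1) (edge_sym u.2).
by rewrite (eq_sym u.1) (eq_sym u.2).
Qed.

Lemma cart_edge_irr : irreflexive cart_edge.
Proof. by move=> u; rewrite /cart_edge /= !edge_irr andbF. Qed.

Definition cart : sgraph := SGraph cart_edge_sym cart_edge_irr.

End CartesianProduct.

Section Minor.
Variable G : sgraph.

(* The subgraph of G induced by A is nonempty and connected. *)
Definition connected_set (A : {set G}) : bool :=
  (A != set0) &&
  [forall x in A, forall y in A,
     connect [rel u v | [&& u \in A, v \in A & edge u v]] x y].

Definition adjacent_sets (A B : {set G}) : bool :=
  [exists x in A, exists y in B, edge x y].

(* H arises from a subgraph of G by contracting connected branch sets B h. *)
Definition minor (H : sgraph) : bool :=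
  [exists B : {ffun H -> {set G}},
    [&& [forall h, connected_set (B h)],
        [forall h, forall k, (h != k) ==> [disjoint B h & B k]] &
        [forall h, forall k, edge h k ==> adjacent_sets (B h) (B k)]]].

Lemma minor_complete0 : exists k, minor (complete k).
Proof.
exists 0; apply/existsP; exists [ffun=> set0].
by apply/and3P; split; apply/forallP => -[].
Qed.

Lemma minor_complete_bound k : minor (complete k) -> k <= #|G|.
Proof.
case/existsP=> B /and3P[/forallP conB /forallP disB _].
have exB h : exists x, x \in B h by apply/set0Pn; case/andP: (conB h).
pose f h := xchoose (exB h).
have f_inj : injective f.
  move=> h j eq_f; apply/eqP/negPn/negP => neq_hj.
  have /implyP/(_ neq_hj) := forallP (disB h) j.
  move/pred0P/(_ (f h)) => /=.
  by rewrite (xchooseP (exB h)) eq_f (xchooseP (exB j)).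
by have := leq_card f f_inj; rewrite card_ord.
Qed.

Definition hadwiger : nat := ex_maxn minor_complete0 minor_complete_bound.

End Minor.

(* K_{n1} [] K_{n2} [] ... [] K_{nd}, associated to the left,
   where ns lists n2, ..., nd. *)
Definition hamming (n1 : nat) (ns : seq nat) : sgraph :=
  foldl cart (complete n1) [seq complete m | m <- ns].

(* Main.v *)
Require Import Defs.
From mathcomp Require Import all_boot all_order all_algebra.
From mathcomp Require Import reals.
From mathcomp Require Import lra zify.
Import Order.TTheory GRing.Theory Num.Theory.
Local Open Scope ring_scope.

(** Lower bound: a K_{k,k}-minor whose two sides are matched up gives a
    K_k-minor, by merging each matched pair of branch sets. The complete graph
    on n1 vertices has such a minor with k = floor(n1/2), and taking the product
    with K_m multiplies k by r whenever r^2 <= m: arrange r^2 vertices of K_m in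
    an r x r square, multiply the branch sets of one side by the rows and those
    of the other side by the columns. A row and a column always meet, so the
    adjacencies persist.

    Upper bound: a K_k-minor uses at least k(k-1) of the arcs of the graph, and
    the Hamming graph has n1...nd vertices, each of degree less than d n1. *)

(** * Connected and adjacent vertex sets, in products and unions *)

Section Connectivity.
Local Open Scope nat_scope.
Set Implicit Arguments.
Unset Strict Implicit.

Lemma edge_cartE (G H : sgraph) (u v : G) (x y : H) :
  @edge (cart G H) (u, x) (v, y) = edge u v && (x == y) || (u == v) && edge x y.
Proof. by []. Qed.

Lemma edge_completeE (n : nat) (x y : 'I_n) : @edge (complete n) x y = (x != y).
Proof. by []. Qed.

(** Names the anonymous relation inside [connected_set], so that paths in an induced subgraph can be
    transported by [connect_homo]. *)
Definition ind_edge (G : sgraph) (A : {set G}) : rel G :=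
  [rel u v | [&& u \in A, v \in A & edge u v]].

Lemma ind_edgeE (G : sgraph) (A : {set G}) (u v : G) :
  ind_edge A u v = [&& u \in A, v \in A & edge u v].
Proof. by []. Qed.

Lemma connected_setP (G : sgraph) (A : {set G}) :
  reflect (A != set0 /\ {in A &, forall x y, connect (ind_edge A) x y})
          (connected_set A).
Proof.
apply: (iffP andP) => -[A0 conA]; split=> //.
  move=> x y xA yA; have /implyP/(_ xA) := forallP conA x.
  by move/forallP/(_ y)/implyP/(_ yA).
apply/forallP=> x; apply/implyP=> xA; apply/forallP=> y; apply/implyP=> yA.
exact: conA.
Qed.

Lemma adjacent_setsP (G : sgraph) (A B : {set G}) :
  reflect (exists x y, [/\ x \in A, y \in B & edge x y]) (adjacent_sets A B).
Proof.
apply: (iffP existsP) => [[x /andP[xA /existsP[y /andP[yB exy]]]]|].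
  by exists x, y.
case=> x [y [xA yB exy]]; exists x; rewrite xA; apply/existsP; exists y.
by rewrite yB.
Qed.

Lemma adjacent_sets_sym (G : sgraph) (A B : {set G}) :
  adjacent_sets A B -> adjacent_sets B A.
Proof.
by case/adjacent_setsP=> x [y [xA yB exy]]; apply/adjacent_setsP;
  exists y, x; rewrite edge_sym.
Qed.

(** Paths are mapped edge by edge. It serves for inclusions of induced subgraphs and for embeddings
    of a factor as a fibre of a product. *)
Lemma connect_homo (T U : finType) (e : rel T) (e' : rel U) (f : T -> U) x y :
  (forall u v, e u v -> e' (f u) (f v)) ->
  connect e x y -> connect e' (f x) (f y).
Proof.
move=> ef /connectP[p]; elim: p x => [x _ ->|z p IH x /=]; first exact: connect0.
case/andP=> exz pz Dy; apply: connect_trans (connect1 (ef _ _ exz)) _.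
exact: IH pz Dy.
Qed.

Lemma connected_set1 (G : sgraph) (x : G) : connected_set [set x].
Proof.
apply/connected_setP; split; first by apply/set0Pn; exists x; rewrite set11.
by move=> u v /set1P-> /set1P->; exact: connect0.
Qed.

Lemma connected_set_complete (n : nat) (A : {set complete n}) :
  A != set0 -> connected_set A.
Proof.
move=> A0; apply/connected_setP; split=> // x y xA yA.
have [->|neq_xy] := eqVneq x y; first exact: connect0.
by apply: connect1; rewrite ind_edgeE edge_completeE xA yA.
Qed.

(** Walk first inside [A] with the second coordinate fixed, then inside [B] with the first one
    fixed. *)
Lemma connected_setX (G H : sgraph) (A : {set G}) (B : {set H}) :
  connected_set A -> connected_set B -> @connected_set (cart G H) (setX A B).
Proof.
case/connected_setP=> /set0Pn[a aA] conA /connected_setP[/set0Pn[b bB] conB].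
apply/connected_setP; split.
  by apply/set0Pn; exists (a, b); rewrite in_setX aA.
case=> x y [x' y'] /setXP[/= xA yB] /setXP[/= x'A y'B].
have inclA: connect (@ind_edge (cart G H) (setX A B)) (x, y) (x', y).
  apply: (@connect_homo _ _ _ _ (fun u : G => (u, y) : cart G H)) (conA _ _ xA x'A).
  move=> u v /and3P[uA vA euv].
  by rewrite ind_edgeE edge_cartE !in_setX /= uA vA yB euv eqxx.
apply: connect_trans inclA _.
apply: (@connect_homo _ _ _ _ (fun u : H => (x', u) : cart G H)) (conB _ _ yB y'B).
move=> u v /and3P[uB vB euv].
by rewrite ind_edgeE edge_cartE !in_setX /= uB vB x'A euv eqxx orbT.
Qed.

Lemma connected_setU (G : sgraph) (A B : {set G}) :
  connected_set A -> connected_set B -> adjacent_sets A B ->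
  connected_set (A :|: B).
Proof.
case/connected_setP=> A0 conA /connected_setP[_ conB].
case/adjacent_setsP=> a [b [aA bB eab]].
have subA x y : x \in A -> y \in A -> connect (ind_edge (A :|: B)) x y.
  move=> xA yA; apply: (@connect_homo _ _ _ _ id) (conA _ _ xA yA).
  by move=> u v /and3P[uA vA euv]; rewrite ind_edgeE !in_setU uA vA.
have subB x y : x \in B -> y \in B -> connect (ind_edge (A :|: B)) x y.
  move=> xB yB; apply: (@connect_homo _ _ _ _ id) (conB _ _ xB yB).
  by move=> u v /and3P[uB vB euv]; rewrite ind_edgeE !in_setU uB vB !orbT.
have ab : connect (ind_edge (A :|: B)) a b.
  by apply: connect1; rewrite ind_edgeE !in_setU aA bB orbT.
have ba : connect (ind_edge (A :|: B)) b a.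
  by apply: connect1; rewrite ind_edgeE !in_setU aA bB orbT edge_sym.
apply/connected_setP; split.
  by apply/set0Pn; exists a; rewrite in_setU aA.
move=> x y /setUP[xA|xB] /setUP[yA|yB]; [exact: subA| | |exact: subB].
  exact: connect_trans (connect_trans (subA _ _ xA aA) ab) (subB _ _ bB yB).
exact: connect_trans (connect_trans (subB _ _ xB bB) ba) (subA _ _ aA yA).
Qed.

End Connectivity.

(** * Lower bound: biclique minors with matched sides *)

Section LowerBound.
Local Open Scope nat_scope.
Set Implicit Arguments.
Unset Strict Implicit.

(** The sides [A] and [B] are matched by their common index. The index type is any finite type of
    size [k], so that a product can be indexed by pairs without renumbering. *)
Definition biclique_minor (G : sgraph) (k : nat) : Prop :=
  exists (I : finType) (A B : I -> {set G}), #|I| = k /\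
  [/\ forall i, connected_set (A i) && connected_set (B i),
      forall i j, i != j -> [disjoint A i & A j] && [disjoint B i & B j],
      forall i j, [disjoint A i & B j] &
      forall i j, adjacent_sets (A i) (B j)].

Lemma biclique_minor_complete (n a : nat) :
  a.*2 <= n -> biclique_minor (complete n) a.
Proof.
(* [inord] requires a successor bound; for [n = 0] the index type is empty. *)
case: n => [|n] le_an.
  have -> : a = 0 by lia.
  exists 'I_0, (fun=> set0), (fun=> set0).
  by rewrite card_ord; split=> //; split=> - [].
have lt1 (i : 'I_a) : i.*2 < n.+1 by have := ltn_ord i; lia.
have lt2 (i : 'I_a) : i.*2.+1 < n.+1 by have := ltn_ord i; lia.
(* Even vertices form one side and odd vertices the other, as singletons. *)
exists 'I_a, (fun i : 'I_a => [set inord i.*2 : complete n.+1]),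
  (fun i : 'I_a => [set inord i.*2.+1 : complete n.+1]).
rewrite card_ord; split=> //; split.
- by move=> i; rewrite !connected_set1.
- move=> i j neq_ij; rewrite !disjoints1 !in_set1 -!val_eqE /= !inordK ?lt1 ?lt2 //.
  by rewrite eqSS (inj_eq double_inj) (inj_eq val_inj) neq_ij.
- move=> i j; rewrite disjoints1 in_set1 -val_eqE /= !inordK ?lt1 ?lt2 //.
  by lia.
- move=> i j; apply/adjacent_setsP; exists (inord i.*2), (inord j.*2.+1).
  rewrite !set11; split=> //.
  rewrite edge_completeE -val_eqE /= !inordK ?lt1 ?lt2 //.
  by lia.
Qed.

Lemma biclique_minor_cart (G : sgraph) (k m r : nat) :
  r * r <= m -> biclique_minor G k ->
  biclique_minor (cart G (complete m)) (k * r).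
Proof.
move=> le_rm [I [A [B [cardI [conAB disAB disjAB adjAB]]]]].
(* Row-major numbering of the square; quotient and remainder by [r] recover the row and the
   column. *)
have lt_pq (p q : 'I_r) : p * r + q < m.
  by have := ltn_ord p; have := ltn_ord q; nia.
pose cell p q : complete m := Ordinal (lt_pq p q).
have cell_inj p q p' q' : cell p q = cell p' q' -> p = p' /\ q = q'.
  move/(congr1 val) => /= E; have r_gt0 : 0 < r.
    exact: leq_ltn_trans (ltn_ord q).
  split; apply: val_inj => /=.
    have := congr1 (divn^~ r) E.
    by rewrite !divnMDl // !divn_small ?ltn_ord // !addn0.
  by have := congr1 (modn^~ r) E; rewrite !modnMDl !modn_small.
pose row p : {set complete m} := [set cell p q | q : 'I_r].
pose col q : {set complete m} := [set cell p q | p : 'I_r].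
exists (I * 'I_r)%type.
exists (fun i => setX (A i.1) (row i.2)), (fun i => setX (B i.1) (col i.2)).
have disX (S S' : {set G}) (T T' : {set complete m}) :
    [disjoint S & S'] || [disjoint T & T'] ->
    [disjoint (setX S T : {set cart G (complete m)}) & setX S' T'].
  rewrite -!setI_eq0 => dis; apply/eqP/setP=> -[x y].
  rewrite !inE /=; apply: contraTF dis => /andP[/andP[xS yT] /andP[xS' yT']].
  by rewrite negb_or; apply/andP; split; apply/set0Pn; [exists x|exists y];
    rewrite inE; apply/andP.
split; first by rewrite card_prod card_ord cardI.
split.
- move=> [i p] /=; have /andP[cA cB] := conAB i.
  apply/andP; split; apply: connected_setX => //; apply: connected_set_complete;
    by apply/set0Pn; exists (cell p p); apply: imset_f.
- move=> [i p] [j q] /=; rewrite -pair_eqE /= negb_and => neq.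
  (* Distinct index pairs differ in the first entry, which separates the factors in [G], or in the
     second, which separates parallel lines of the square. *)
  have [/andP[dA dB]|dRC] : [disjoint A i & A j] && [disjoint B i & B j] \/
      [disjoint row p & row q] && [disjoint col p & col q].
  + case/orP: neq => [neq_ij|neq_pq]; [by left; apply: disAB | right].
    by apply/andP; split; rewrite -setI_eq0; apply/eqP/setP=> x; rewrite !inE;
      apply: contraNF neq_pq => /andP[/imsetP[p' _ ->] /imsetP[q' _]] /cell_inj[];
      move=> E1 E2; apply/eqP.
  + by apply/andP; split; apply: disX; rewrite ?dA ?dB.
  + by case/andP: dRC => dR dC; apply/andP; split;
      apply: disX; rewrite ?dR ?dC orbT.
(* Rows and columns meet, so opposite sides are separated by their factors in [G]. *)
- by move=> [i p] [j q]; apply: disX; rewrite disjAB.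
- move=> [i p] [j q] /=; have /adjacent_setsP[u [v [uA vB euv]]] := adjAB i j.
  (* The edge [u v] is lifted to the fibre over the common cell of row [p] and column [q]. *)
  apply/adjacent_setsP; exists (u, cell p q), (v, cell p q).
  have rowP : cell p q \in row p by apply: imset_f.
  have colP : cell p q \in col q by apply: (imset_f (cell^~ q)).
  by split; rewrite ?edge_cartE ?in_setX /= ?uA ?vB ?euv ?eqxx.
Qed.

Lemma biclique_minor_hadwiger (G : sgraph) (k : nat) :
  biclique_minor G k -> k <= hadwiger G.
Proof.
case=> I [A [B [<- [conAB disAB disjAB adjAB]]]].
rewrite /hadwiger; case: ex_maxnP => h _; apply.
apply/existsP.
exists [ffun i : complete #|I| => A (enum_val i) :|: B (enum_val i)].
apply/and3P; split.
- apply/forallP=> i; rewrite ffunE; have /andP[cA cB] := conAB (enum_val i).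
  exact: connected_setU.
- apply/forallP=> i; apply/forallP=> j; apply/implyP=> neq_ij; rewrite !ffunE.
  have neq : enum_val i != enum_val j by rewrite (inj_eq enum_val_inj).
  (* The intersection of two merged pairs splits into four intersections, each empty by one of these
     facts. *)
  have /andP[] := disAB _ _ neq.
  have := disjAB (enum_val j) (enum_val i); have := disjAB (enum_val i) (enum_val j).
  rewrite (disjoint_sym (A (enum_val j)) (B _)) -!setI_eq0 setIUl !setIUr.
  by do 4!move/eqP->; rewrite !setU0.
- apply/forallP=> i; apply/forallP=> j; apply/implyP=> _; rewrite !ffunE.
  have /adjacent_setsP[x [y [xA yB exy]]] := adjAB (enum_val i) (enum_val j).
  by apply/adjacent_setsP; exists x, y; rewrite !in_setU xA yB orbT.
Qed.

(** The product associates to the left, so inductions on the factors peel off the last one. *)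
Lemma hamming_rcons (n m : nat) (ns : seq nat) :
  hamming n (rcons ns m) = cart (hamming n ns) (complete m).
Proof. by rewrite /hamming map_rcons foldl_rcons. Qed.

(** An abstract [r] lets the floor of the real square root be plugged in directly. *)
Lemma biclique_minor_hamming (n a : nat) (ns : seq nat) (r : nat -> nat) :
  a.*2 <= n -> (forall m, r m * r m <= m) ->
  biclique_minor (hamming n ns) (a * \prod_(m <- ns) r m).
Proof.
move=> le_an le_r; elim/last_ind: ns => [|ns m IH].
  by rewrite big_nil muln1; exact: biclique_minor_complete.
by rewrite hamming_rcons big_rcons /= mulnA; exact: biclique_minor_cart.
Qed.

End LowerBound.

(** * Upper bound: counting arcs by the maximum degree *)

Section UpperBound.
Local Open Scope nat_scope.
Set Implicit Arguments.
Unset Strict Implicit.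

Definition max_degree_le (G : sgraph) (D : nat) : Prop :=
  forall u : G, #|[set v | edge u v]| <= D.

Lemma max_degree_complete (n : nat) : max_degree_le (complete n) n.-1.
Proof.
move=> u; have -> : [set v | edge u v] = [set~ u].
  by apply/setP=> v; rewrite !inE edge_completeE eq_sym.
by rewrite cardsC1 card_ord.
Qed.

Lemma max_degree_cart (G H : sgraph) (D E : nat) :
  max_degree_le G D -> max_degree_le H E -> max_degree_le (cart G H) (D + E).
Proof.
move=> degG degH [u x].
have sub : [set v | @edge (cart G H) (u, x) v] \subset
    setX [set v | edge u v] [set x] :|: setX [set u] [set y | edge x y].
  by apply/subsetP=> -[v y]; rewrite !inE edge_cartE /= (eq_sym x) (eq_sym u).
apply: leq_trans (subset_leq_card sub) _; apply: leq_trans (leq_card_setU _ _) _.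
by rewrite !cardsX !cards1 muln1 mul1n leq_add.
Qed.

(** Each branch set has a neighbour in each of the [k.-1] others, and these are distinct by
    disjointness; yet it has at most [#|B i| * D] neighbours. Summing over the branch sets gives the
    bound. *)
Lemma minor_complete_arcs (G : sgraph) (D k : nat) :
  max_degree_le G D -> minor G (complete k) -> k * k.-1 <= #|G| * D.
Proof.
move=> degG /existsP[B /and3P[/forallP conB /forallP disB /forallP adjB]].
have disBP i j x : x \in B i -> x \in B j -> i = j.
  move=> xi xj; apply/eqP/negPn/negP => neq_ij.
  have /implyP/(_ neq_ij)/pred0P/(_ x) := forallP (disB i) j.
  by rewrite /= xi xj.
have nbr i : k.-1 <= #|B i| * D.
  have /andP[/set0Pn[x0 _] _] := conB i.
  pose N := \bigcup_(u in B i) [set v | edge u v].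
  (* The implication makes the choice function total; at [j = i] any vertex, here [x0], will do. *)
  have exN j : exists v, (j != i) ==> (v \in B j) && (v \in N).
    have [->|neq] := eqVneq j i; first by exists x0.
    have /implyP := forallP (adjB i) j.
    rewrite edge_completeE eq_sym neq => /(_ isT).
    case/adjacent_setsP=> u [v [uB vB euv]]; exists v; rewrite vB /=.
    by apply/bigcupP; exists u; rewrite ?inE.
  pose f j := xchoose (exN j).
  have fP j : j != i -> f j \in B j /\ f j \in N.
    by move=> neq; have /implyP/(_ neq)/andP := xchooseP (exN j).
  have -> : k.-1 = #|f @: [set~ i]|.
    rewrite card_in_imset ?cardsC1 ?card_ord // => j j'; rewrite !inE => nj nj' E.
    have [fj _] := fP _ nj; have [fj' _] := fP _ nj'.
    by apply: disBP fj _; rewrite E.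
  apply: (@leq_trans #|N|).
    apply/subset_leq_card/subsetP=> _ /imsetP[j nj ->].
    by rewrite !inE in nj; case: (fP _ nj).
  rewrite -sum_nat_const /N.
  elim/big_ind2: _ => [|S s1 T t1 leS leT|u _]; [by rewrite cards0| |exact: degG].
  exact: leq_trans (leq_card_setU _ _) (leq_add leS leT).
(* Double counting: each vertex lies in at most one branch set. *)
have sumB : \sum_i #|B i| <= #|G|.
  under eq_bigr do rewrite -sum1_card big_mkcond /=.
  rewrite exchange_big /= -sum1_card; apply: leq_sum => x _.
  rewrite -big_mkcond sum1_card; apply/card_le1_eqP => i j xi xj.
  exact: disBP xj xi.
apply: leq_trans (leq_mul sumB (leqnn D)); rewrite big_distrl /=.
rewrite -{1}[k]card_ord -sum_nat_const; exact: leq_sum.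
Qed.

Lemma card_hamming (n : nat) (ns : seq nat) :
  #|hamming n ns| = n * \prod_(m <- ns) m.
Proof.
elim/last_ind: ns => [|ns m IH]; first by rewrite big_nil muln1 card_ord.
by rewrite hamming_rcons card_prod IH card_ord big_rcons /= mulnA.
Qed.

(** Degrees add over the factors, and each factor contributes less than its order, hence at most
    [n]. *)
Lemma max_degree_hamming (n : nat) (ns : seq nat) :
  (forall m, m \in ns -> m <= n) ->
  max_degree_le (hamming n ns) ((size ns).+1 * n).
Proof.
elim/last_ind: ns => [_ u|ns m IH le_n].
  by rewrite mul1n; apply: leq_trans (max_degree_complete _) (leq_pred _).
rewrite hamming_rcons size_rcons mulSnr => u.
apply: (max_degree_cart (IH _) _).
  by move=> p p_ns; apply: le_n; rewrite mem_rcons inE p_ns orbT.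
move=> v; apply: leq_trans (max_degree_complete _) (leq_trans (leq_pred _) _).
by apply: le_n; rewrite mem_rcons mem_head.
Qed.

Lemma hadwiger_minor (G : sgraph) : minor G (complete (hadwiger G)).
Proof. by rewrite /hadwiger; case: ex_maxnP. Qed.

End UpperBound.

(** * Transfer of both natural-number bounds to floors and real square roots *)

Theorem mainTheorem8 (R : realType) (n1 : nat) (ns : seq nat)
    (n_sorted : sorted geq (n1 :: ns))
    (n_ge2 : forall m : nat, m \in n1 :: ns -> (2 <= m)%N) :
  let d := size (n1 :: ns) in
  let eta := hadwiger (hamming n1 ns) in
  (Num.floor (n1%:R / 2 : R) *
     \prod_(m <- ns) Num.floor (Num.sqrt (m%:R : R)) <= eta%:Z) /\
  ((eta%:R : R) <
     Num.sqrt d%:R * n1%:R * \prod_(m <- ns) Num.sqrt m%:R + 3).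
Proof.
move=> d eta; split.
(* Floors of nonnegative reals are rewritten as naturals, which reduces the integer inequality to
   one in [nat]. *)
- have floorE (x : R) : 0 <= x ->
      Num.floor x = (`|Num.floor x|%N)%:Z /\ (`|Num.floor x|%N)%:R <= x.
    move=> x0; have f0 : 0 <= Num.floor x by rewrite floor_ge0.
    have E : Num.floor x = (`|Num.floor x|%N)%:Z by rewrite gez0_abs.
    by split=> //; have := floor_le x; rewrite {1}E.
  have [a a0] := floorE (n1%:R / 2) (divr_ge0 (ler0n _ _) (ler0n _ _)).
  rewrite a; under eq_bigr => m _ do rewrite (floorE _ (sqrtr_ge0 _)).1.
  rewrite -(big_morph Posz PoszM (erefl _)) -PoszM lez_nat.
  apply: biclique_minor_hadwiger; apply: biclique_minor_hamming => [|m].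
    rewrite -(ler_nat R) -muln2 natrM; lra.
  have [_ le] := floorE _ (sqrtr_ge0 (m%:R : R)).
  rewrite -(ler_nat R) natrM -expr2 -[leRHS]sqr_sqrtr ?ler0n //.
  by rewrite ler_sqr ?nnegrE ?sqrtr_ge0 ?ler0n.
- have le_n1 m : m \in ns -> (m <= n1)%N.
    have geq_trans : transitive geq by move=> x y z /= xy yz; apply: leq_trans yz xy.
    have /= := n_sorted; rewrite (path_sortedE geq_trans) => /andP[/allP le _].
    exact: le.
  have := minor_complete_arcs (@max_degree_hamming n1 ns le_n1) (hadwiger_minor _).
  rewrite -/eta card_hamming -/d -(ler_nat R) !natrM natr_prod => arcs.
  set S := Num.sqrt _ * _ * _.
  have S0 : 0 <= S.
    by rewrite !mulr_ge0 ?sqrtr_ge0 ?prodr_ge0 // => m _; rewrite sqrtr_ge0.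
  (* The right side is the number of vertices times the degree bound, exactly as in [arcs]. *)
  have SE : S ^+ 2 = n1%:R * (\prod_(m <- ns) m%:R) * (d%:R * n1%:R).
    rewrite !exprMn sqr_sqrtr ?ler0n // -prodrXl.
    under eq_bigr do rewrite sqr_sqrtr ?ler0n //.
    by lra.
  (* An inequality, because the predecessor is truncated at [0]. *)
  have le_pred : (eta%:R - 1 : R) <= eta.-1%:R.
    by case: (eta) => [|e]; rewrite /= -?natr1; lra.
  rewrite -SE in arcs; have e0 : 0 <= (eta.-1%:R : R) := ler0n _ _.
  (* If [eta] were at least [S + 3], then [eta * eta.-1] would be at least [(S + 3) * (S + 2)],
     which exceeds [S ^+ 2] and contradicts [arcs]. *)
  rewrite ltNge; apply/negP=> le_S; nra.
Qed.
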